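(* Let $\vec\beta=(\beta_1,\beta_2)$ be such that $0<\beta_1<\beta_2$, and let $\vec c=(c_1,c_2)$, $\vec b=(b_1,b_2)$ be pairs of positive real numbers. Then, for $$D^{\vec\beta}_{\vec c,\vec b}(\lambda)=\#\left\{(k_1,k_2)\in\mathbb{N}^2:\ (c_1k_1+b_1)^{\beta_1}(c_2k_2+b_2)^{\beta_2}\le\lambda\right\},$$ we have, as $\lambda\to\infty$, $$D^{\vec\beta}_{\vec c,\vec b}(\lambda)=\frac{\zeta(\beta_2/\beta_1;b_2/c_2)}{c_1c_2^{\beta_2/\beta_1}}\lambda^{\frac1{\beta_1}}+\frac{\zeta(\beta_1/\beta_2;b_1/c_1)}{c_2c_1^{\beta_1/\beta_2}}\lambda^{\frac1{\beta_2}}+O\!\left(\lambda^{\frac1{\beta_1+\beta_2}}\right).$$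
   Context: Here $\mathbb{N}=\{0,1,2,\dots\}$ (the factors $(c_jk_j+b_j)^{\beta_j}$, $k_j\ge0$, enumerate the sequence $(c_j(k-1)+b_j)^{\beta_j}$, $k=1,2,\dots$). For $a>0$, $\zeta(z;a)$ is the Hurwitz zeta function, $\zeta(z;a)=\sum_{k=0}^\infty(k+a)^{-z}$ for $\operatorname{Re}z>1$, meromorphically continued to $\mathbb{C}$ with a single simple pole at $z=1$. *)

(* Defs.v *)
From Stdlib Require Import Reals Lra Lia List Ensembles Finite_sets Finite_sets_facts ClassicalEpsilon.
From Coquelicot Require Import Coquelicot.

Open Scope R_scope.

(* x^z = exp (z ln x) for real x > 0 and complex z, split into real and
   imaginary parts (Coquelicot has no complex exponential). *)
Definition Cpower (x : R) (z : C) : C :=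
  (exp (Re z * ln x) * cos (Im z * ln x), exp (Re z * ln x) * sin (Im z * ln x)).

Definition analytic_at (f : C -> C) (z0 : C) : Prop :=
  exists (a : nat -> C) (r : R), 0 < r /\
    forall z : C, Cmod (z - z0) < r ->
      is_pseries (K := C_AbsRing) (V := C_NormedModule) a (z - z0)%C (f z).

Definition simple_pole_at (f : C -> C) (z0 : C) : Prop :=
  exists g : C -> C, analytic_at g z0 /\ g z0 <> RtoC 0 /\
    exists r : R, 0 < r /\
      forall z : C, z <> z0 -> Cmod (z - z0) < r -> f z = (g z / (z - z0))%C.

(* [Z] is the function zeta(.; a): the meromorphic continuation to C, with a
   single simple pole at 1, of the Hurwitz series on Re z > 1.  This determines
   [Z] everywhere except for its irrelevant value at the pole. *)
Definition is_hurwitz_zeta (a : R) (Z : C -> C) : Prop :=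
  (forall z : C, 1 < Re z ->
     is_series (K := C_AbsRing) (V := C_NormedModule)
       (fun k : nat => Cpower (INR k + a) (- z)%C) (Z z)) /\
  (forall z : C, z <> RtoC 1 -> analytic_at Z z) /\
  simple_pole_at Z (RtoC 1).

Definition lattice_set (beta1 beta2 c1 c2 b1 b2 lambda : R) : Ensemble (nat * nat) :=
  fun k => Rpower (c1 * INR (fst k) + b1) beta1
           * Rpower (c2 * INR (snd k) + b2) beta2 <= lambda.

(* The number of elements of [A]; arbitrary when [A] is infinite. *)
Definition card {U : Type} (A : Ensemble U) : nat :=
  epsilon (inhabits 0%nat) (cardinal U A).

Definition Dcount (beta1 beta2 c1 c2 b1 b2 lambda : R) : nat :=
  card (lattice_set beta1 beta2 c1 c2 b1 b2 lambda).

Lemma Finite_list {U : Type} (l : list U) : Finite_sets.Finite U (fun x => List.In x l).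
Proof.
induction l as [|y l IH].
- apply Finite_downward_closed with (Empty_set U); [constructor|].
  intros x Hx; destruct Hx.
- apply Finite_downward_closed with (Add U (fun x => List.In x l) y).
  + now apply Add_preserves_Finite.
  + intros x [->|Hx]; [right; constructor|left; exact Hx].
Qed.

Lemma Rpower_affine_bound (beta c b M : R) :
  0 < beta -> 0 < c -> 0 < b ->
  exists N : nat, forall k : nat, Rpower (c * INR k + b) beta <= M -> (k < N)%nat.
Proof.
intros Hbeta Hc Hb.
destruct (INR_unbounded (exp (ln (Rmax M 1) / beta) / c)) as [N HN].
exists N; intros k Hk.
destruct (Nat.lt_ge_cases k N) as [|Hle]; [assumption|exfalso].
apply le_INR in Hle.
assert (HM : 0 < Rmax M 1) by (generalize (Rmax_r M 1); lra).
assert (H1 : exp (ln (Rmax M 1) / beta) < c * INR k + b).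
{ apply (Rmult_lt_compat_l c) in HN; [|assumption].
  replace (c * (exp (ln (Rmax M 1) / beta) / c))
    with (exp (ln (Rmax M 1) / beta)) in HN by (field; lra).
  apply (Rmult_le_compat_l c) in Hle; lra. }
assert (H2 : Rpower (exp (ln (Rmax M 1) / beta)) beta < Rpower (c * INR k + b) beta)
  by (apply Rlt_Rpower_l; [assumption|split; [apply exp_pos|exact H1]]).
unfold Rpower at 1 in H2; rewrite ln_exp in H2.
replace (beta * (ln (Rmax M 1) / beta)) with (ln (Rmax M 1)) in H2 by (field; lra).
rewrite exp_ln in H2 by assumption.
generalize (Rmax_l M 1); lra.
Qed.

Lemma lattice_set_finite (beta1 beta2 c1 c2 b1 b2 lambda : R) :
  0 < beta1 -> 0 < beta2 -> 0 < c1 -> 0 < c2 -> 0 < b1 -> 0 < b2 ->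
  Finite_sets.Finite (nat * nat) (lattice_set beta1 beta2 c1 c2 b1 b2 lambda).
Proof.
intros He1 He2 Hc1 Hc2 Hb1 Hb2.
assert (Hlow : forall beta c b k, 0 < beta -> 0 < c -> 0 < b ->
          Rpower b beta <= Rpower (c * INR k + b) beta).
{ intros beta c b k Hbeta Hc Hb; apply Rle_Rpower_l; [lra|].
  generalize (Rmult_le_pos c (INR k) (Rlt_le _ _ Hc) (pos_INR k)); lra. }
assert (Hpos : forall x y, 0 < Rpower x y) by (intros; apply exp_pos).
destruct (Rpower_affine_bound beta1 c1 b1 (lambda / Rpower b2 beta2)) as [N1 HN1]; auto.
destruct (Rpower_affine_bound beta2 c2 b2 (lambda / Rpower b1 beta1)) as [N2 HN2]; auto.
apply Finite_downward_closed
  with (fun x => List.In x (list_prod (seq 0 N1) (seq 0 N2))); [apply Finite_list|].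
intros [k1 k2] Hk; unfold Ensembles.In, lattice_set in *; simpl in Hk.
apply in_prod; apply in_seq; split; try lia; simpl.
- apply HN1, (Rmult_le_reg_r (Rpower b2 beta2)); [apply Hpos|].
  replace (lambda / Rpower b2 beta2 * Rpower b2 beta2) with lambda
    by (field; apply Rgt_not_eq, Hpos).
  eapply Rle_trans; [|exact Hk].
  apply Rmult_le_compat_l; [apply Rlt_le, Hpos|now apply Hlow].
- apply HN2, (Rmult_le_reg_l (Rpower b1 beta1)); [apply Hpos|].
  replace (Rpower b1 beta1 * (lambda / Rpower b1 beta1)) with lambda
    by (field; apply Rgt_not_eq, Hpos).
  eapply Rle_trans; [|exact Hk].
  apply Rmult_le_compat_r; [apply Rlt_le, Hpos|now apply Hlow].
Qed.

Lemma Dcount_spec (beta1 beta2 c1 c2 b1 b2 lambda : R) :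
  0 < beta1 -> 0 < beta2 -> 0 < c1 -> 0 < c2 -> 0 < b1 -> 0 < b2 ->
  cardinal (nat * nat) (lattice_set beta1 beta2 c1 c2 b1 b2 lambda)
    (Dcount beta1 beta2 c1 c2 b1 b2 lambda).
Proof.
intros; unfold Dcount, card; apply epsilon_spec.
now apply finite_cardinal, lattice_set_finite.
Qed.

(* Main.v *)
Require Import Defs.
From Stdlib Require Import Reals Lra Lia Factorial List.
From Stdlib Require Import Ensembles Finite_sets Finite_sets_facts.
From Coquelicot Require Import Coquelicot.

Open Scope R_scope.

(** Write [a_i = b_i / c_i], [u = k_1 + a_1], [v = k_2 + a_2], [s = beta1 / beta2].
    The points to be counted satisfy [u^beta1 v^beta2 <= X^(beta1 + beta2)], where
    [X] is a constant multiple of [lambda^(1 / (beta1 + beta2))]; the error term is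
    thus [O(X)].

    Dirichlet's hyperbola method ([hyperbola_method]) splits the count into the
    strips [u <= X] and [v <= X], minus the square [u, v <= X].  The column above
    [u] has [X^(1+s) u^(-s) + O(1)] points, and
    [sum_{u <= X} u^(-s) = zeta(s; a_1) + X^(1-s) / (1-s) + O(X^(-s))]
    ([hurwitz_partial_sum]), so the first strip contains
    [X^(1+s) zeta(s; a_1) + X^2 / (1-s) + O(X)] points ([strip_count]).  The second
    strip is treated in the same way, with [1/s] in place of [s].  Since
    [1 / (1-s) + 1 / (1-1/s) = 1], the two terms in [X^2] cancel against the square,
    which has [X^2 + O(X)] points ([lattice_count]).

    It remains to identify the constant [hurwitz a s] of the partial sums with the
    value of the meromorphic continuation for [0 < s < 1] ([hurwitz_zeta_real]).
    The factor [s - 1] removes the simple pole ([pole_removed]), so the comparison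
    can be made along the real axis.  There [(s - 1) hurwitz a s] is real-analytic
    on [s > 0] ([hurwitz_regular_analytic]): it is a series of functions of [s] whose
    Taylor coefficients satisfy summable Cauchy-type bounds, hence can be summed
    coefficientwise ([is_pseries_Series]).  Both functions agree for [s > 1], where
    the Hurwitz series converges, and the identity theorem on a half-line
    ([real_analytic_identity]) gives equality for all [s > 0]. *)

(** * Partial sums of the Hurwitz series *)

(** The finite sum [f 0 + ... + f (n - 1)], empty for [n = 0]. *)
Fixpoint psum (f : nat -> R) (n : nat) : R :=
  match n with
  | O => 0
  | S m => psum f m + f m
  end.

Lemma sum_n_psum (f : nat -> R) (n : nat) : sum_n f n = psum f (S n).
Proof.
induction n as [|n IH].
- rewrite sum_O; simpl; ring.
- rewrite sum_Sn, IH; reflexivity.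
Qed.

Lemma is_series_psum (f : nat -> R) (l : R) :
  is_series f l <-> is_lim_seq (psum f) l.
Proof.
rewrite (is_lim_seq_incr_1 (psum f)); split; intros H.
- apply (is_lim_seq_ext (sum_n f)); [intros n; apply sum_n_psum|exact H].
- assert (H' : is_lim_seq (sum_n f) l); [|exact H'].
  apply (is_lim_seq_ext (fun n => psum f (S n))); [|exact H].
  intros n; symmetry; apply sum_n_psum.
Qed.

Lemma psum_scal (c : R) (f : nat -> R) (n : nat) :
  psum (fun k => c * f k) n = c * psum f n.
Proof. induction n as [|n IH]; simpl; [|rewrite IH]; ring. Qed.

Lemma psum_const (c : R) (n : nat) : psum (fun _ => c) n = INR n * c.
Proof. induction n as [|n IH]; [|rewrite S_INR]; simpl; [|rewrite IH]; ring. Qed.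

Lemma psum_Rabs_diff (f g : nat -> R) (B : R) (n : nat) :
  (forall k, (k < n)%nat -> Rabs (f k - g k) <= B) ->
  Rabs (psum f n - psum g n) <= INR n * B.
Proof.
induction n as [|n IH]; intros H.
- simpl; rewrite Rminus_diag, Rabs_R0; lra.
- rewrite S_INR; simpl.
  replace (psum f n + f n - (psum g n + g n))
    with ((psum f n - psum g n) + (f n - g n)) by ring.
  eapply Rle_trans; [apply Rabs_triang|].
  assert (H1 := H n (Nat.lt_succ_diag_r n)).
  assert (H2 : Rabs (psum f n - psum g n) <= INR n * B)
    by (apply IH; intros k Hk; apply H; lia).
  lra.
Qed.

(** A nonnegative series dominated by a nonnegative telescoping one converges,
    and its tails are dominated by the terms of the telescoping sequence. *)
Lemma telescoping_domination (d t : nat -> R) :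
  (forall k, 0 <= d k <= t k - t (S k)) -> (forall k, 0 <= t k) ->
  ex_series d /\ forall n, 0 <= Series d - psum d n <= t n.
Proof.
intros Hd Ht.
assert (Hdiff : forall n m, 0 <= psum d (n + m) - psum d n <= t n - t (n + m)%nat).
{ intros n m; induction m as [|m IH].
  - rewrite Nat.add_0_r; lra.
  - rewrite Nat.add_succ_r; simpl; generalize (Hd (n + m)%nat); lra. }
assert (Hex : ex_finite_lim_seq (psum d)).
{ apply ex_finite_lim_seq_incr with (t 0%nat).
  - intros n; simpl; generalize (Hd n); lra.
  - intros n; generalize (Hdiff 0%nat n) (Ht n); simpl; lra. }
destruct Hex as [l Hl].
assert (Hs : is_series d l) by now apply is_series_psum.
split; [now exists l|].
intros n; rewrite (is_series_unique _ _ Hs).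
assert (Hl' : is_lim_seq (fun m => psum d (m + n)) l)
  by now apply is_lim_seq_incr_n.
split.
- assert (H : Rbar_le (psum d n) l).
  { apply (is_lim_seq_le (fun _ => psum d n) (fun m => psum d (m + n)));
      [|apply is_lim_seq_const|exact Hl'].
    intros m; rewrite Nat.add_comm; generalize (Hdiff n m); lra. }
  simpl in H; lra.
- assert (H : Rbar_le l (t n + psum d n)).
  { apply (is_lim_seq_le (fun m => psum d (m + n)) (fun _ => t n + psum d n));
      [|exact Hl'|apply is_lim_seq_const].
    intros m; rewrite Nat.add_comm; generalize (Hdiff n m) (Ht (n + m)%nat); lra. }
  simpl in H; lra.
Qed.

Lemma Rpower_pos (x y : R) : 0 < Rpower x y.
Proof. apply exp_pos. Qed.

Lemma Rpower_decr (u v s : R) :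
  0 <= s -> 0 < u <= v -> Rpower v (- s) <= Rpower u (- s).
Proof.
intros Hs [Hu Huv]; rewrite !Rpower_Ropp.
apply Rinv_le_contravar; [apply Rpower_pos|apply Rle_Rpower_l; lra].
Qed.

Lemma is_lim_Rpower_neg (s : R) :
  0 < s -> is_lim_seq (fun n => Rpower (INR n) (- s)) 0.
Proof.
intros Hs; apply (is_lim_seq_incr_1 (fun n => Rpower (INR n) (- s))).
apply is_lim_seq_spec; intros eps.
destruct (INR_unbounded (Rpower eps (- (1 / s)))) as [N HN].
exists N; intros n Hn; rewrite Rminus_0_r, Rabs_pos_eq by apply Rlt_le, Rpower_pos.
assert (H : Rpower eps (- (1 / s)) < INR (S n))
  by (apply Rlt_le_trans with (1 := HN), le_INR; lia).
assert (H' : Rpower (Rpower eps (- (1 / s))) s < Rpower (INR (S n)) s)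
  by (apply Rlt_Rpower_l; [|split; [apply Rpower_pos|]]; assumption).
rewrite Rpower_mult in H'; replace (- (1 / s) * s) with (- (1)) in H' by (field; lra).
rewrite Rpower_Ropp, Rpower_1 in H' by apply eps.
rewrite Rpower_Ropp, <- (Rinv_inv eps).
apply Rinv_lt_contravar; [|exact H'].
apply Rmult_lt_0_compat; [apply Rinv_0_lt_compat, eps|apply Rpower_pos].
Qed.

(** [u^(1-s) / (1-s)] is an antiderivative of [u^(-s)]. *)
Lemma Rpower_increment (u v s : R) :
  0 < s -> s <> 1 -> 0 < u <= v ->
  (v - u) * Rpower v (- s) <= (Rpower v (1 - s) - Rpower u (1 - s)) / (1 - s)
    <= (v - u) * Rpower u (- s).
Proof.
intros Hs Hs1 [Hu [Huv| <-]]; [|unfold Rdiv; rewrite !Rminus_diag, !Rmult_0_l; lra].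
destruct (MVT_cor2 (fun x => Rpower x (1 - s))
            (fun x => (1 - s) * Rpower x (1 - s - 1)) u v Huv) as [c [Hc Huc]].
{ intros c Hc; apply derivable_pt_lim_power; lra. }
replace (1 - s - 1) with (- s) in Hc by ring.
replace ((Rpower v (1 - s) - Rpower u (1 - s)) / (1 - s))
  with ((v - u) * Rpower c (- s)) by (rewrite Hc; field; lra).
split; apply Rmult_le_compat_l; try lra; apply Rpower_decr; lra.
Qed.

(** For real [s > 0], [s <> 1], the difference between the [k]-th term of the
    Hurwitz series and the integral of [x^(-s)] over [[k + a, k + a + 1]]. *)
Definition hurwitz_defect (a s : R) (k : nat) : R :=
  Rpower (INR k + a) (- s)
  - (Rpower (INR (S k) + a) (1 - s) - Rpower (INR k + a) (1 - s)) / (1 - s).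

(** The value of the Hurwitz zeta function at a real [s > 0], [s <> 1]: the sum
    of the defects plus the regularised integral of [x^(-s)] over [[a, oo)]. *)
Definition hurwitz (a s : R) : R :=
  Series (hurwitz_defect a s) - Rpower a (1 - s) / (1 - s).

Lemma hurwitz_defect_series (a s : R) :
  0 < a -> 0 < s -> s <> 1 ->
  ex_series (hurwitz_defect a s) /\
  forall n, 0 <= Series (hurwitz_defect a s) - psum (hurwitz_defect a s) n
              <= Rpower (INR n + a) (- s).
Proof.
intros Ha Hs Hs1.
apply (telescoping_domination _ (fun n => Rpower (INR n + a) (- s))).
- intros k; unfold hurwitz_defect; generalize (pos_INR k); intros Hk.
  destruct (Rpower_increment (INR k + a) (INR (S k) + a) s Hs Hs1) as [H1 H2];
    rewrite S_INR in *; [lra|].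
  replace (INR k + 1 + a - (INR k + a)) with 1 in * by ring; lra.
- intros k; apply Rlt_le, Rpower_pos.
Qed.

Lemma psum_Rpower_hurwitz (a s : R) (n : nat) :
  0 < a -> 0 < s -> s <> 1 ->
  Rabs (psum (fun k => Rpower (INR k + a) (- s)) n
        - (hurwitz a s + Rpower (INR n + a) (1 - s) / (1 - s)))
    <= Rpower (INR n + a) (- s).
Proof.
intros Ha Hs Hs1.
destruct (hurwitz_defect_series a s Ha Hs Hs1) as [_ H]; specialize (H n).
assert (E : psum (fun k => Rpower (INR k + a) (- s)) n
            = psum (hurwitz_defect a s) n
              + (Rpower (INR n + a) (1 - s) - Rpower a (1 - s)) / (1 - s)).
{ clear H; induction n as [|n IH].
  - simpl; rewrite (Rplus_0_l a); field; lra.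
  - simpl psum; rewrite IH; unfold hurwitz_defect; field; lra. }
rewrite E; unfold hurwitz.
replace (_ - _) with
  (- (Series (hurwitz_defect a s) - psum (hurwitz_defect a s) n)) by (field; lra).
rewrite Rabs_Ropp, Rabs_pos_eq; lra.
Qed.

Lemma is_lim_Rpower_shift (a s : R) :
  0 < a -> 0 < s -> is_lim_seq (fun n => Rpower (INR n + a) (- s)) 0.
Proof.
intros Ha Hs; apply is_lim_seq_incr_1.
apply (is_lim_seq_le_le (fun _ => 0) _ (fun n => Rpower (INR (S n)) (- s))).
- intros n; split; [apply Rlt_le, Rpower_pos|].
  generalize (pos_INR n); intros Hn; apply Rpower_decr; rewrite ?S_INR; lra.
- apply is_lim_seq_const.
- apply (is_lim_seq_incr_1 (fun n => Rpower (INR n) (- s))), is_lim_Rpower_neg, Hs.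
Qed.

Lemma is_series_hurwitz (a s : R) :
  0 < a -> 1 < s -> is_series (fun k => Rpower (INR k + a) (- s)) (hurwitz a s).
Proof.
intros Ha Hs; apply is_series_psum.
set (c := fun n => hurwitz a s + Rpower (INR n + a) (1 - s) / (1 - s)).
assert (Hc : is_lim_seq c (hurwitz a s + 0 / (1 - s))).
{ apply is_lim_seq_plus'; [apply is_lim_seq_const|].
  apply is_lim_seq_div'; [|apply is_lim_seq_const|lra].
  apply (is_lim_seq_ext (fun n => Rpower (INR n + a) (- (s - 1)))).
  - intros n; f_equal; ring.
  - apply is_lim_Rpower_shift; lra. }
replace (hurwitz a s + 0 / (1 - s)) with (hurwitz a s) in Hc by (field; lra).
assert (He := is_lim_Rpower_shift a s Ha ltac:(lra)).
apply (is_lim_seq_le_le (fun n => c n - Rpower (INR n + a) (- s)) _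
         (fun n => c n + Rpower (INR n + a) (- s))).
- intros n; assert (H := psum_Rpower_hurwitz a s n Ha ltac:(lra) ltac:(lra)).
  fold (c n) in H; apply Rabs_le_between in H; lra.
- rewrite <- (Rminus_0_r (hurwitz a s)); apply is_lim_seq_minus'; assumption.
- rewrite <- (Rplus_0_r (hurwitz a s)); apply is_lim_seq_plus'; assumption.
Qed.

(** * Real-analytic functions *)

(** [f] is the sum of a convergent power series on a neighbourhood of [x0]. *)
Definition real_analytic_at (f : R -> R) (x0 : R) : Prop :=
  exists (a : nat -> R) (r : R), 0 < r /\
    forall x, Rabs (x - x0) < r -> is_pseries a (x - x0) (f x).

Lemma real_analytic_at_ext (f g : R -> R) (x0 r : R) :
  0 < r -> (forall x, Rabs (x - x0) < r -> f x = g x) ->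
  real_analytic_at f x0 -> real_analytic_at g x0.
Proof.
intros Hr Hfg [a [r' [Hr' Ha]]].
exists a, (Rmin r r'); split; [now apply Rmin_pos|].
intros x Hx; rewrite <- Hfg.
- apply Ha; eapply Rlt_le_trans; [exact Hx|apply Rmin_r].
- eapply Rlt_le_trans; [exact Hx|apply Rmin_l].
Qed.

Lemma real_analytic_at_minus (f g : R -> R) (x0 : R) :
  real_analytic_at f x0 -> real_analytic_at g x0 ->
  real_analytic_at (fun x => f x - g x) x0.
Proof.
intros [a [r [Hr Ha]]] [b [r' [Hr' Hb]]].
exists (PS_minus a b), (Rmin r r'); split; [now apply Rmin_pos|].
intros x Hx; apply (is_pseries_minus a b).
- apply Ha; eapply Rlt_le_trans; [exact Hx|apply Rmin_l].
- apply Hb; eapply Rlt_le_trans; [exact Hx|apply Rmin_r].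
Qed.

Lemma real_analytic_at_mult_linear (f : R -> R) (c x0 : R) :
  real_analytic_at f x0 -> real_analytic_at (fun x => (x - c) * f x) x0.
Proof.
intros [a [r [Hr Ha]]].
exists (PS_plus (PS_scal (x0 - c) a) (PS_incr_1 a)), r; split; [exact Hr|].
intros x Hx.
replace ((x - c) * f x) with (plus (scal (x0 - c) (f x)) (scal (x - x0) (f x)))
  by (unfold plus, scal; simpl; unfold mult; simpl; ring).
apply (is_pseries_plus (PS_scal (x0 - c) a) (PS_incr_1 a)).
- apply (is_pseries_scal (K := R_AbsRing) (V := R_NormedModule));
    [apply Rmult_comm|now apply Ha].
- now apply (is_pseries_incr_1 (K := R_AbsRing) (V := R_NormedModule)), Ha.
Qed.

Lemma pseries_zero_right_constant (a : nat -> R) (r : R) :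
  0 < r -> (forall y, 0 < y < r -> is_pseries a y 0) -> a 0%nat = 0.
Proof.
intros Hr Ha.
assert (Hcv : Rbar_lt (Rabs 0) (CV_radius a)).
{ rewrite Rabs_R0; apply Rbar_lt_le_trans with (Rabs (r / 2)).
  - simpl; rewrite Rabs_pos_eq; lra.
  - apply Rbar_not_lt_le; intros H; apply (CV_disk_outside _ _ H).
    apply ex_series_lim_0; exists 0.
    apply (proj1 (is_pseries_R a (r / 2) 0)), Ha; lra. }
assert (Hc := PSeries_continuity a 0 Hcv); rewrite <- (PSeries_0 a).
destruct (Req_dec (PSeries a 0) 0) as [|Hn]; [assumption|exfalso].
destruct (Hc (Rabs (PSeries a 0)) (Rabs_pos_lt _ Hn)) as [d [Hd H]].
assert (Hm : 0 < Rmin d r) by now apply Rmin_pos.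
assert (Hmd := Rmin_l d r); assert (Hmr := Rmin_r d r).
specialize (H (Rmin d r / 2)).
rewrite (is_pseries_unique _ _ _ (Ha (Rmin d r / 2) ltac:(lra))) in H.
simpl in H; unfold Rdist in H.
rewrite Rminus_0_r, Rminus_0_l, Rabs_Ropp in H.
apply (Rlt_irrefl (Rabs (PSeries a 0))), H; split.
- split; [exact I|lra].
- rewrite Rabs_pos_eq; lra.
Qed.

(** A power series whose sum vanishes on a right neighbourhood of [0] is zero. *)
Lemma pseries_zero_right (a : nat -> R) (r : R) (n : nat) :
  0 < r -> (forall y, 0 < y < r -> is_pseries a y 0) -> a n = 0.
Proof.
intros Hr; revert a; induction n as [|n IH]; intros a Ha.
- now apply pseries_zero_right_constant with r.
- change (PS_decr_1 a n = 0); apply IH; intros y Hy.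
  replace 0 with (scal (/ y) (plus 0 (opp (a 0%nat)))).
  + apply (is_pseries_decr_1 (K := R_AbsRing) (V := R_NormedModule));
      [unfold mult, one; simpl; field; lra|now apply Ha].
  + rewrite (pseries_zero_right_constant a r Hr Ha).
    unfold plus, scal, opp; simpl; unfold mult; simpl; ring.
Qed.

Lemma real_analytic_zero_right (f : R -> R) (t : R) :
  real_analytic_at f t -> (forall y, t < y -> f y = 0) ->
  exists r, 0 < r /\ forall y, Rabs (y - t) < r -> f y = 0.
Proof.
intros [a [r [Hr Ha]]] Hf; exists r; split; [exact Hr|]; intros y Hy.
assert (Ha0 : forall n, a n = 0).
{ intros n; apply pseries_zero_right with r; [exact Hr|]; intros z Hz.
  rewrite <- (Hf (t + z)) by lra.
  replace z with (t + z - t) at 1 by ring.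
  apply Ha; replace (t + z - t) with z by ring; rewrite Rabs_pos_eq; lra. }
rewrite <- (is_pseries_unique _ _ _ (Ha y Hy)).
rewrite (PSeries_ext a (fun _ => 0)) by exact Ha0; apply PSeries_const_0.
Qed.

(** Identity theorem on the half-line [(l, oo)]: the vanishing of [f] propagates
    to the left, by a supremum argument. *)
Lemma real_analytic_identity (f : R -> R) (l c : R) :
  (forall x, l < x -> real_analytic_at f x) ->
  (forall x, c < x -> f x = 0) ->
  forall x, l < x -> f x = 0.
Proof.
intros Hf Hc x Hx.
destruct (Rlt_le_dec c x) as [|Hxc]; [now apply Hc|].
set (E := fun s => s <= c - x /\ forall y, c - s < y -> f y = 0).
destruct (completeness E) as [m [Hub Hleast]].
{ exists (c - x); intros s Hs; apply Hs. }
{ exists 0; split; [lra|]; intros y Hy; apply Hc; lra. }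
assert (Hm : m <= c - x) by (apply Hleast; intros s Hs; apply Hs).
assert (Hright : forall y, c - m < y -> f y = 0).
{ intros y Hy.
  destruct (Req_dec (f y) 0) as [|Hn]; [assumption|exfalso].
  assert (H : m <= c - y); [|lra].
  apply Hleast; intros s [_ Hs].
  apply Rnot_lt_le; intros Hlt; apply Hn, Hs; lra. }
destruct (real_analytic_zero_right f (c - m)) as [r [Hr Hzero]];
  [apply Hf; lra|exact Hright|].
destruct (Req_dec m (c - x)) as [Hmx|Hmx].
- apply Hzero; replace (x - (c - m)) with 0 by lra; rewrite Rabs_R0; lra.
- exfalso; assert (Hs : E (Rmin (c - x) (m + r))).
  { split; [apply Rmin_l|]; intros y Hy.
    destruct (Rlt_le_dec (c - m) y) as [|Hle]; [now apply Hright|].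
    apply Hzero, Rabs_def1; generalize (Rmin_r (c - x) (m + r)); lra. }
  apply Hub in Hs; revert Hs; apply Rlt_not_le, Rmin_glb_lt; lra.
Qed.

(** * From complex to real analyticity *)

Lemma sum_n_fst (u : nat -> C) (n : nat) :
  fst (sum_n u n) = sum_n (fun k => fst (u k)) n.
Proof.
induction n as [|n IH]; [now rewrite !sum_O|].
rewrite !sum_Sn, <- IH; reflexivity.
Qed.

Lemma sum_n_snd (u : nat -> C) (n : nat) :
  snd (sum_n u n) = sum_n (fun k => snd (u k)) n.
Proof.
induction n as [|n IH]; [now rewrite !sum_O|].
rewrite !sum_Sn, <- IH; reflexivity.
Qed.

Lemma is_series_C (u : nat -> C) (l : C) :
  is_series (K := C_AbsRing) (V := C_NormedModule) u l ->
  is_series (fun k => Re (u k)) (Re l) /\ is_series (fun k => Im (u k)) (Im l).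
Proof.
intros H; split.
- apply (filterlim_ext (fun n => fst (sum_n (G := C_NormedModule) u n)));
    [intros n; apply sum_n_fst|].
  eapply filterlim_comp; [exact H|].
  destruct l as [x y].
  apply (continuous_fst (U := R_UniformSpace) (V := R_UniformSpace)).
- apply (filterlim_ext (fun n => snd (sum_n (G := C_NormedModule) u n)));
    [intros n; apply sum_n_snd|].
  eapply filterlim_comp; [exact H|].
  destruct l as [x y].
  apply (continuous_snd (U := R_UniformSpace) (V := R_UniformSpace)).
Qed.

Lemma pow_n_RtoC (y : R) (n : nat) : pow_n (K := C_Ring) (RtoC y) n = RtoC (y ^ n).
Proof.
induction n as [|n IH]; [reflexivity|].
simpl; rewrite IH, RtoC_mult; reflexivity.
Qed.

Lemma is_pseries_C_real (a : nat -> C) (y : R) (l : C) :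
  is_pseries (K := C_AbsRing) (V := C_NormedModule) a (RtoC y) l ->
  is_pseries (fun n => Re (a n)) y (Re l) /\
  is_pseries (fun n => Im (a n)) y (Im l).
Proof.
intros H; destruct (is_series_C _ _ H) as [H1 H2]; split; apply is_pseries_R.
- apply is_series_ext with (2 := H1).
  intros n; rewrite pow_n_RtoC; unfold scal, Re; simpl; unfold mult; simpl; ring.
- apply is_series_ext with (2 := H2).
  intros n; rewrite pow_n_RtoC; unfold scal, Im; simpl; unfold mult; simpl; ring.
Qed.

Lemma analytic_at_real (f : C -> C) (x0 : R) :
  analytic_at f (RtoC x0) ->
  real_analytic_at (fun x => Re (f (RtoC x))) x0 /\
  real_analytic_at (fun x => Im (f (RtoC x))) x0.
Proof.
intros [a [r [Hr Ha]]].
assert (H : forall x, Rabs (x - x0) < r ->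
          is_pseries (K := C_AbsRing) (V := C_NormedModule) a (RtoC (x - x0))
            (f (RtoC x))).
{ intros x Hx; rewrite RtoC_minus; apply Ha.
  rewrite <- RtoC_minus, Cmod_R; exact Hx. }
split; [exists (fun n => Re (a n)), r|exists (fun n => Im (a n)), r];
  (split; [exact Hr|intros x Hx]).
- exact (proj1 (is_pseries_C_real _ _ _ (H x Hx))).
- exact (proj2 (is_pseries_C_real _ _ _ (H x Hx))).
Qed.

(** The simple pole of the zeta function is removed by the factor [x - 1], so
    that the real axis can be followed from [x > 1] down to [0 < x < 1]. *)
Lemma pole_removed (a : R) (Z : C -> C) :
  is_hurwitz_zeta a Z ->
  exists p q : R -> R,
    (forall x, x <> 1 -> p x = (x - 1) * Re (Z (RtoC x))
                         /\ q x = (x - 1) * Im (Z (RtoC x))) /\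
    (forall x, real_analytic_at p x /\ real_analytic_at q x).
Proof.
intros [_ [Han [g [Hg [_ [r [Hr Hgr]]]]]]].
exists
  (fun x => if Req_dec_T x 1 then Re (g (RtoC 1)) else (x - 1) * Re (Z (RtoC x))),
  (fun x => if Req_dec_T x 1 then Im (g (RtoC 1)) else (x - 1) * Im (Z (RtoC x))).
split.
- intros x Hx; destruct (Req_dec_T x 1); [contradiction|split; reflexivity].
- intros x0; destruct (Req_dec_T x0 1) as [->|Hx0].
  + destruct (analytic_at_real g 1 Hg) as [H1 H2].
    assert (E : forall x, x <> 1 -> Rabs (x - 1) < r ->
              g (RtoC x) = (RtoC (x - 1) * Z (RtoC x))%C).
    { intros x Hx Hxr; rewrite Hgr.
      - rewrite <- RtoC_minus; field; intros H; apply RtoC_inj in H; lra.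
      - intros H; apply RtoC_inj in H; contradiction.
      - rewrite <- RtoC_minus, Cmod_R; exact Hxr. }
    split; [revert H1|revert H2]; apply real_analytic_at_ext with r; trivial;
      intros x Hxr; destruct (Req_dec_T x 1) as [->|Hx]; try reflexivity;
      rewrite E by assumption; unfold Re, Im; simpl; ring.
  + destruct (analytic_at_real Z x0) as [H1 H2].
    { apply Han; intros H; apply RtoC_inj in H; contradiction. }
    assert (Hd : 0 < Rabs (x0 - 1)) by (apply Rabs_pos_lt; lra).
    split; [apply (real_analytic_at_mult_linear _ 1) in H1; revert H1
           |apply (real_analytic_at_mult_linear _ 1) in H2; revert H2];
      apply real_analytic_at_ext with (1 := Hd);
      intros x Hx; destruct (Req_dec_T x 1) as [->|]; try reflexivity;
      exfalso; rewrite Rabs_minus_sym in Hx; lra.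
Qed.

(** * Analyticity of the Hurwitz zeta function on the half-line [s > 0] *)

Lemma ex_series_Rabs_le (a b : nat -> R) :
  (forall k, Rabs (a k) <= b k) -> ex_series b -> ex_series a.
Proof. exact (ex_series_le (K := R_AbsRing) (V := R_CompleteNormedModule) a b). Qed.

Lemma geometric_tail (a : nat -> R) (l B q : R) (n : nat) :
  0 <= q < 1 -> (forall k, Rabs (a k) <= B * q ^ k) -> is_series a l ->
  Rabs (l - psum a n) <= B * q ^ n / (1 - q).
Proof.
intros Hq Ha Hl.
assert (HB : 0 <= B).
{ generalize (Ha 0%nat) (Rabs_pos (a 0%nat)); simpl; lra. }
assert (Hfin : forall m, Rabs (psum a (m + n) - psum a n) <= B * q ^ n / (1 - q)).
{ intros m.
  apply Rle_trans with (B * q ^ n * (1 - q ^ m) / (1 - q)).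
  - induction m as [|m IH].
    + simpl; rewrite Rminus_diag, Rabs_R0; right; field; lra.
    + simpl psum; replace (psum a (m + n) + a (m + n)%nat - psum a n)
        with ((psum a (m + n) - psum a n) + a (m + n)%nat) by ring.
      eapply Rle_trans; [apply Rabs_triang|].
      eapply Rle_trans; [apply Rplus_le_compat; [exact IH|apply Ha]|].
      right; rewrite pow_add; simpl; field; lra.
  - unfold Rdiv; apply Rmult_le_compat_r; [apply Rlt_le, Rinv_0_lt_compat; lra|].
    rewrite <- (Rmult_1_r (B * q ^ n)) at 2; apply Rmult_le_compat_l.
    + apply Rmult_le_pos; [exact HB|apply pow_le; lra].
    + generalize (pow_le q m (proj1 Hq)); lra. }
assert (Hlim : is_lim_seq (fun m => Rabs (psum a (m + n) - psum a n))
                 (Rabs (l - psum a n))).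
{ apply (is_lim_seq_abs (fun m => psum a (m + n) - psum a n) (l - psum a n)).
  apply is_lim_seq_minus'; [|apply is_lim_seq_const].
  now apply (is_lim_seq_incr_n (psum a)), is_series_psum. }
exact (is_lim_seq_le _ _ (Rabs (l - psum a n)) (B * q ^ n / (1 - q))
         Hfin Hlim (is_lim_seq_const _)).
Qed.

Lemma Series_psum (c : nat -> nat -> R) (N : nat) :
  (forall n, ex_series (fun k => c k n)) ->
  ex_series (fun k => psum (c k) N) /\
  Series (fun k => psum (c k) N) = psum (fun n => Series (fun k => c k n)) N.
Proof.
intros Hc; induction N as [|N [IH1 IH2]]; simpl.
- assert (H0 : is_series (fun _ : nat => 0) 0).
  { apply is_series_psum, (is_lim_seq_ext (fun _ => 0)); [|apply is_lim_seq_const].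
    intros n; rewrite psum_const; ring. }
  split; [now exists 0|exact (is_series_unique _ _ H0)].
- split.
  + exact (ex_series_plus (fun k => psum (c k) N) (fun k => c k N) IH1 (Hc N)).
  + rewrite (Series_plus (fun k => psum (c k) N) (fun k => c k N)) by auto.
    now rewrite IH2.
Qed.

(** A series of power series may be summed coefficientwise when the
    coefficients of its [k]-th term satisfy a Cauchy-type bound [M k / r^n]
    with [M] summable. *)
Lemma is_pseries_Series (c : nat -> nat -> R) (M f : nat -> R) (r y : R) :
  Rabs y < r -> (forall k n, Rabs (c k n) * r ^ n <= M k) -> ex_series M ->
  (forall k, is_pseries (c k) y (f k)) ->
  is_pseries (fun n => Series (fun k => c k n)) y (Series f).
Proof.
intros Hy Hc HM Hf.
assert (Hr : 0 < r) by (generalize (Rabs_pos y); lra).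
set (q := Rabs y / r).
assert (Hq : 0 <= q < 1).
{ unfold q; split; [apply Rdiv_le_0_compat; [apply Rabs_pos|exact Hr]|].
  apply Rlt_div_l; lra. }
assert (Hcq : forall k n, Rabs (c k n * y ^ n) <= M k * q ^ n).
{ intros k n; rewrite Rabs_mult, <- RPow_abs; unfold q, Rdiv.
  rewrite Rpow_mult_distr, pow_inv.
  replace (M k * (Rabs y ^ n * / r ^ n)) with (M k * / r ^ n * Rabs y ^ n) by ring.
  apply Rmult_le_compat_r; [apply pow_le, Rabs_pos|].
  apply Rle_div_r; [apply pow_lt, Hr|apply Hc]. }
assert (Hex : forall n, ex_series (fun k => c k n * y ^ n)).
{ intros n; apply (ex_series_Rabs_le _ (fun k => M k * q ^ n)).
  - intros k; apply Hcq.
  - now apply ex_series_scal_r. }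
assert (Htail : forall N k,
          Rabs (f k - psum (fun n => c k n * y ^ n) N) <= M k * (q ^ N / (1 - q))).
{ intros N k.
  replace (M k * (q ^ N / (1 - q))) with (M k * q ^ N / (1 - q)) by (unfold Rdiv; ring).
  apply geometric_tail; [exact Hq|apply Hcq|].
  apply (proj1 (is_pseries_R _ _ _)), Hf. }
assert (Hexf : ex_series f).
{ apply (ex_series_Rabs_le _ (fun k => M k * (q ^ 0 / (1 - q)))).
  - intros k; generalize (Htail 0%nat k); simpl psum; rewrite Rminus_0_r; intros H; exact H.
  - now apply ex_series_scal_r. }
apply (proj2 (is_pseries_R _ _ _)).
assert (Herr : forall N,
          Rabs (Series f - psum (fun n => Series (fun k => c k n) * y ^ n) N)
            <= Series M * (q ^ N / (1 - q))).
{ intros N.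
  destruct (Series_psum (fun k n => c k n * y ^ n) N Hex) as [E1 E2].
  replace (psum (fun n => Series (fun k => c k n) * y ^ n) N)
    with (Series (fun k => psum (fun n => c k n * y ^ n) N)).
  - rewrite <- Series_minus by assumption.
    assert (HMq : ex_series (fun k => M k * (q ^ N / (1 - q))))
      by now apply ex_series_scal_r.
    rewrite <- Series_scal_r.
    eapply Rle_trans; [apply Series_Rabs|apply Series_le; [|exact HMq]].
    + apply (ex_series_Rabs_le _ (fun k => M k * (q ^ N / (1 - q)))); [|exact HMq].
      intros k; rewrite Rabs_Rabsolu; apply Htail.
    + intros k; split; [apply Rabs_pos|apply Htail].
  - rewrite E2; clear; induction N as [|N IH]; simpl; [reflexivity|].
    now rewrite IH, Series_scal_r. }
apply is_series_psum.
set (S := psum (fun n => Series (fun k => c k n) * y ^ n)) in *.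
assert (Hgeom : is_lim_seq (fun N => Series M * (q ^ N / (1 - q))) 0).
{ replace (Finite 0) with (Rbar_mult (Series M) (0 / (1 - q))).
  - apply is_lim_seq_scal_l, is_lim_seq_div'; [|apply is_lim_seq_const|lra].
    apply is_lim_seq_geom; rewrite Rabs_pos_eq; lra.
  - simpl; f_equal; field; lra. }
apply (is_lim_seq_le_le (fun N => Series f - Series M * (q ^ N / (1 - q))) _
         (fun N => Series f + Series M * (q ^ N / (1 - q)))).
- intros N; specialize (Herr N); apply Rabs_le_between in Herr; lra.
- rewrite <- (Rminus_0_r (Series f)) at 1.
  apply is_lim_seq_minus'; [apply is_lim_seq_const|exact Hgeom].
- rewrite <- (Rplus_0_r (Series f)) at 1.
  apply is_lim_seq_plus'; [apply is_lim_seq_const|exact Hgeom].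
Qed.

(** [exp_term (S n) z = z^n / n!], with [exp_term 0 z = 0]: the shift makes
    [z]-differentiation the map [m |-> pred m] for every index. *)
Definition exp_term (m : nat) (z : R) : R :=
  match m with
  | O => 0
  | S n => z ^ n / INR (fact n)
  end.

Lemma is_derive_exp_term (m : nat) (z : R) :
  is_derive (exp_term m) z (exp_term (pred m) z).
Proof.
destruct m as [|n]; simpl.
- apply (is_derive_const 0).
- destruct n as [|n]; [simpl|].
  + apply (is_derive_ext (fun _ => 1)); [intros t; simpl; field|apply (is_derive_const 1)].
  + assert (Hn := INR_fact_neq_0 n); assert (Hn0 := pos_INR n).
    assert (E : INR (fact (S n)) = INR (S n) * INR (fact n))
      by now rewrite fact_simpl, mult_INR.
    change (is_derive (fun x => x ^ S n / INR (fact (S n))) z (z ^ n / INR (fact n))).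
    rewrite E; auto_derive; [exact I|].
    change (match n with O => 1 | S _ => INR n + 1 end) with (INR (S n)).
    rewrite S_INR; field; split; [exact Hn|lra].
Qed.

Lemma is_series_exp_term (x : R) : is_series (fun n => exp_term (S n) x) (exp x).
Proof.
apply (is_series_ext (fun n => / INR (fact n) * x ^ n)).
- intros n; simpl; unfold Rdiv; ring.
- apply (proj1 (is_pseries_R _ _ _)), is_exp_Reals.
Qed.

(** Cauchy-type estimate: a term of the exponential series of [r |z|] is at
    most its sum. *)
Lemma exp_term_bound (m : nat) (z r : R) :
  0 < r -> Rabs (exp_term m z) * r ^ m <= r * exp (r * Rabs z).
Proof.
intros Hr; destruct m as [|n].
- simpl; rewrite Rabs_R0; generalize (exp_pos (r * Rabs z)); intros; nra.
- unfold exp_term; rewrite Rabs_div, <- RPow_abs by apply INR_fact_neq_0.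
  rewrite (Rabs_pos_eq (INR (fact n))) by apply pos_INR.
  replace (Rabs z ^ n / INR (fact n) * r ^ S n)
    with (r * ((r * Rabs z) ^ n / INR (fact n)))
    by (rewrite Rpow_mult_distr; simpl; unfold Rdiv; ring).
  apply Rmult_le_compat_l; [lra|].
  assert (Hp : 0 <= r * Rabs z) by (apply Rmult_le_pos; [lra|apply Rabs_pos]).
  eapply Rle_trans; [|apply (exp_ge_taylor _ n Hp)].
  set (t := fun k : nat => _).
  destruct n as [|n]; [right; reflexivity|].
  rewrite tech5; change ((r * Rabs z) ^ S n / INR (fact (S n))) with (t (S n)).
  assert (0 <= sum_f_R0 t n); [|lra].
  apply cond_pos_sum; intros k; unfold t; apply Rdiv_le_0_compat;
    [now apply pow_le|apply INR_fact_lt_0].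
Qed.

(** [power_term alpha (S n) u] is the coefficient of [y^n] in the expansion of
    [u^(alpha - y)]. *)
Definition power_term (alpha : R) (m : nat) (u : R) : R :=
  Rpower u alpha * exp_term m (- ln u).

Lemma is_pseries_power_term (alpha u y : R) :
  is_pseries (fun n => power_term alpha (S n) u) y (Rpower u (alpha - y)).
Proof.
apply (proj2 (is_pseries_R _ _ _)).
replace (Rpower u (alpha - y)) with (Rpower u alpha * exp (y * - ln u))
  by (unfold Rpower; rewrite <- exp_plus; f_equal; ring).
apply (is_series_ext (fun n => Rpower u alpha * exp_term (S n) (y * - ln u))).
- intros n; unfold power_term, exp_term; rewrite Rpow_mult_distr; unfold Rdiv.
  match goal with |- ?l = ?r => change (@eq R l r) end; ring.
- apply (is_series_scal (K := R_AbsRing) (V := R_NormedModule)), is_series_exp_term.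
Qed.

Lemma is_derive_power_term (alpha u : R) (m : nat) :
  0 < u ->
  is_derive (power_term alpha m) u
    (alpha * power_term (alpha - 1) m u - power_term (alpha - 1) (pred m) u).
Proof.
intros Hu.
assert (H1 : is_derive (fun x => Rpower x alpha) u (alpha * Rpower u (alpha - 1)))
  by now apply is_derive_Reals, derivable_pt_lim_power.
assert (H2 : is_derive (fun x => - ln x) u (- / u))
  by (auto_derive; [exact Hu|ring]).
assert (H3 := is_derive_comp (exp_term m) (fun x => - ln x) u _ _
                (is_derive_exp_term m (- ln u)) H2).
assert (H := is_derive_mult _ _ u _ _ H1 H3 Rmult_comm).
replace (_ - _) with (plus (mult (alpha * Rpower u (alpha - 1)) (exp_term m (- ln u)))
  (mult (Rpower u alpha) (scal (- / u) (exp_term (pred m) (- ln u))))); [exact H|].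
unfold power_term, plus, mult, scal; simpl; unfold mult; simpl.
replace (Rpower u alpha) with (u * Rpower u (alpha - 1)).
- field; lra.
- rewrite <- (Rpower_1 u) at 1 by exact Hu.
  rewrite <- Rpower_plus; f_equal; ring.
Qed.

Lemma power_term_bound (alpha u r : R) (m : nat) :
  0 < u -> 0 < r ->
  Rabs (power_term alpha m u) * r ^ m
    <= r * (Rpower u (alpha + r) + Rpower u (alpha - r)).
Proof.
intros Hu Hr; unfold power_term; rewrite Rabs_mult.
rewrite (Rabs_pos_eq (Rpower u alpha)) by apply Rlt_le, Rpower_pos.
rewrite Rmult_assoc.
apply Rle_trans with (Rpower u alpha * (r * exp (r * Rabs (- ln u)))).
- apply Rmult_le_compat_l; [apply Rlt_le, Rpower_pos|now apply exp_term_bound].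
- replace (Rpower u alpha * (r * exp (r * Rabs (- ln u))))
    with (r * (Rpower u alpha * exp (r * Rabs (- ln u)))) by ring.
  apply Rmult_le_compat_l; [lra|].
  unfold Rpower; rewrite <- exp_plus, Rabs_Ropp.
  assert (E1 := exp_pos ((alpha + r) * ln u)); assert (E2 := exp_pos ((alpha - r) * ln u)).
  unfold Rabs; destruct (Rcase_abs (ln u)).
  + replace (alpha * ln u + r * - ln u) with ((alpha - r) * ln u) by ring; lra.
  + replace (alpha * ln u + r * ln u) with ((alpha + r) * ln u) by ring; lra.
Qed.

(** First-order Taylor estimate on [[u, u + 1]]. *)
Lemma taylor1_bound (F F1 F2 : R -> R) (u B : R) :
  (forall x, u <= x <= u + 1 -> is_derive F x (F1 x)) ->
  (forall x, u <= x <= u + 1 -> is_derive F1 x (F2 x)) ->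
  (forall x, u <= x <= u + 1 -> Rabs (F2 x) <= B) ->
  Rabs (F (u + 1) - F u - F1 u) <= B.
Proof.
intros H1 H2 HB.
destruct (MVT_cor2 F F1 u (u + 1)) as [c [Hc Huc]]; [lra|..].
{ intros c Hc; now apply is_derive_Reals, H1. }
destruct (MVT_cor2 F1 F2 u c) as [d [Hd Hud]]; [lra|..].
{ intros d Hd; apply is_derive_Reals, H2; lra. }
replace (F (u + 1) - F u - F1 u) with (F2 d * (c - u)) by lra.
rewrite Rabs_mult, (Rabs_pos_eq (c - u)) by lra.
specialize (HB d ltac:(lra)); generalize (Rabs_pos (F2 d)); nra.
Qed.

(** The coefficient of [(x - x0)^n] in
    [(u + 1)^(1 - x) - u^(1 - x) - (1 - x) u^(- x)]. *)
Definition defect_coef (x0 u : R) (n : nat) : R :=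
  power_term (1 - x0) (S n) (u + 1) - power_term (1 - x0) (S n) u
  - ((1 - x0) * power_term (- x0) (S n) u - power_term (- x0) n u).

Lemma is_pseries_defect_coef (x0 u x : R) :
  is_pseries (defect_coef x0 u) (x - x0)
    (Rpower (u + 1) (1 - x) - Rpower u (1 - x) - (1 - x) * Rpower u (- x)).
Proof.
assert (H : forall alpha v, is_pseries (fun n => power_term alpha (S n) v) (x - x0)
              (Rpower v (alpha + x0 - x))).
{ intros alpha v; replace (alpha + x0 - x) with (alpha - (x - x0)) by ring.
  apply is_pseries_power_term. }
assert (H1 := H (1 - x0) (u + 1)); assert (H2 := H (1 - x0) u); assert (H3 := H (- x0) u).
replace (1 - x0 + x0 - x) with (1 - x) in H1, H2 by ring.
replace (- x0 + x0 - x) with (- x) in H3 by ring.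
assert (H4 := is_pseries_scal (K := R_AbsRing) (V := R_NormedModule) (1 - x0)
                _ _ _ (Rmult_comm _ _) H3).
assert (H5 := is_pseries_incr_1 (K := R_AbsRing) (V := R_NormedModule) _ _ _ H3).
assert (H6 := is_pseries_minus _ _ _ _ _ (is_pseries_minus _ _ _ _ _ H1 H2)
                 (is_pseries_minus _ _ _ _ _ H4 H5)).
apply (is_pseries_ext _ (defect_coef x0 u)) in H6.
- replace (Rpower (u + 1) (1 - x) - Rpower u (1 - x) - (1 - x) * Rpower u (- x)) with
    (plus (plus (Rpower (u + 1) (1 - x)) (opp (Rpower u (1 - x))))
       (opp (plus (scal (1 - x0) (Rpower u (- x))) (opp (scal (x - x0) (Rpower u (- x)))))));
    [exact H6|].
  unfold plus, opp, scal; simpl; unfold mult; simpl; ring.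
- intros n; unfold defect_coef, PS_minus, PS_plus, PS_opp, PS_scal.
  unfold plus, opp, scal; simpl; unfold mult; simpl.
  destruct n as [|n]; simpl; [|ring].
  unfold zero, power_term; simpl; ring.
Qed.

(** By the Taylor estimate in [u] for [power_term], with two derivatives
    lowering the exponent by [2]; both resulting exponents are below [-1], so
    that the bound is summable over [u = k + a]. *)
Lemma defect_coef_bound (x0 r : R) :
  0 < r -> r < x0 ->
  exists C, forall u n, 0 < u ->
    Rabs (defect_coef x0 u n) * r ^ n
      <= C * (Rpower u (- (1 + x0 - r)) + Rpower u (- (1 + x0 + r))).
Proof.
intros Hr Hrx.
exists (Rabs ((1 - x0) * - x0) + Rabs (1 - x0 + - x0) * r + r * r).
intros u n Hu.
set (alpha := 1 - x0).
set (E := Rpower u (- (1 + x0 - r)) + Rpower u (- (1 + x0 + r))).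
set (C := _ + r * r).
assert (Hrn : 0 < r ^ n) by now apply pow_lt.
assert (Hbound : forall m v, u <= v ->
          Rabs (power_term (alpha - 1 - 1) m v) * r ^ m <= r * E).
{ intros m v Huv; eapply Rle_trans; [apply power_term_bound; lra|].
  apply Rmult_le_compat_l; [lra|]; unfold E, alpha.
  replace (1 - x0 - 1 - 1 + r) with (- (1 + x0 - r)) by ring.
  replace (1 - x0 - 1 - 1 - r) with (- (1 + x0 + r)) by ring.
  apply Rplus_le_compat; apply Rpower_decr; lra. }
assert (HE : 0 <= E).
{ apply Rplus_le_le_0_compat; apply Rlt_le, Rpower_pos. }
assert (H0 : forall v, u <= v -> Rabs (power_term (alpha - 1 - 1) (S n) v) * r ^ n <= E).
{ intros v Hv; specialize (Hbound (S n) v Hv); simpl in Hbound.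
  apply Rmult_le_reg_l with r; [exact Hr|]; lra. }
assert (H1 : forall v, u <= v -> Rabs (power_term (alpha - 1 - 1) n v) * r ^ n <= r * E).
{ intros v Hv; exact (Hbound n v Hv). }
assert (H2 : forall v, u <= v ->
          Rabs (power_term (alpha - 1 - 1) (pred n) v) * r ^ n <= r * r * E).
{ intros v Hv; destruct n as [|m]; simpl.
  - unfold power_term; simpl; rewrite Rmult_0_r, Rabs_R0, Rmult_0_l.
    repeat apply Rmult_le_pos; lra.
  - specialize (Hbound m v Hv); nra. }
apply Rle_trans with (C * E / r ^ n * r ^ n); [|right; field; lra].
apply Rmult_le_compat_r; [lra|].
unfold defect_coef; fold alpha; replace (- x0) with (alpha - 1) by (unfold alpha; ring).
apply (taylor1_bound (power_term alpha (S n))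
         (fun v => alpha * power_term (alpha - 1) (S n) v - power_term (alpha - 1) n v)
         (fun v => alpha * ((alpha - 1) * power_term (alpha - 1 - 1) (S n) v
                            - power_term (alpha - 1 - 1) n v)
                   - ((alpha - 1) * power_term (alpha - 1 - 1) n v
                      - power_term (alpha - 1 - 1) (pred n) v))).
- intros v Hv; apply (is_derive_power_term alpha v (S n)); lra.
- intros v Hv.
  apply (is_derive_minus (fun w => alpha * power_term (alpha - 1) (S n) w)
           (power_term (alpha - 1) n)).
  + apply (is_derive_scal (power_term (alpha - 1) (S n)) v alpha).
    apply (is_derive_power_term (alpha - 1) v (S n)); lra.
  + apply is_derive_power_term; lra.
- intros v Hv.
  specialize (H0 v (proj1 Hv)); specialize (H1 v (proj1 Hv)); specialize (H2 v (proj1 Hv)).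
  apply Rle_div_r; [exact Hrn|].
  set (p0 := power_term (alpha - 1 - 1) (S n) v) in *.
  set (p1 := power_term (alpha - 1 - 1) n v) in *.
  set (p2 := power_term (alpha - 1 - 1) (pred n) v) in *.
  replace (alpha * ((alpha - 1) * p0 - p1) - ((alpha - 1) * p1 - p2))
    with (alpha * (alpha - 1) * p0 + (- ((alpha + (alpha - 1)) * p1) + p2)) by ring.
  assert (HA : Rabs (alpha * (alpha - 1) * p0 + (- ((alpha + (alpha - 1)) * p1) + p2))
               <= Rabs (alpha * (alpha - 1)) * Rabs p0
                  + (Rabs (alpha + (alpha - 1)) * Rabs p1 + Rabs p2)).
  { eapply Rle_trans; [apply Rabs_triang|]; rewrite Rabs_mult.
    apply Rplus_le_compat_l; eapply Rle_trans; [apply Rabs_triang|].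
    rewrite Rabs_Ropp, Rabs_mult; lra. }
  apply (Rmult_le_compat_r (r ^ n)) in HA; [|lra].
  eapply Rle_trans; [exact HA|].
  unfold C; replace (- x0) with (alpha - 1) by (unfold alpha; ring).
  change (1 - x0) with alpha.
  set (A := Rabs (alpha * (alpha - 1))); set (B := Rabs (alpha + (alpha - 1))).
  assert (HA0 : 0 <= A) by apply Rabs_pos; assert (HB0 : 0 <= B) by apply Rabs_pos.
  apply (Rmult_le_compat_l A) in H0; [|exact HA0].
  apply (Rmult_le_compat_l B) in H1; [|exact HB0].
  lra.
Qed.

(** [(s - 1) zeta(s; a)] for real [s], continued to [s > 0]; the value at
    [s = 1] is included. *)
Definition hurwitz_regular (a s : R) : R :=
  Rpower a (1 - s)
  + Series (fun k => Rpower (INR k + a + 1) (1 - s) - Rpower (INR k + a) (1 - s)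
                     - (1 - s) * Rpower (INR k + a) (- s)).

Lemma hurwitz_regularE (a s : R) :
  s <> 1 -> hurwitz_regular a s = (s - 1) * hurwitz a s.
Proof.
intros Hs; unfold hurwitz_regular, hurwitz.
rewrite Rmult_minus_distr_l, <- Series_scal_l, Rplus_comm; unfold Rminus at 1.
rewrite (Series_ext _ (fun k => (s - 1) * hurwitz_defect a s k)).
- field; lra.
- intros k; unfold hurwitz_defect; rewrite S_INR.
  replace (INR k + 1 + a) with (INR k + a + 1) by ring; field; lra.
Qed.

Lemma hurwitz_regular_analytic (a s : R) :
  0 < a -> 0 < s -> real_analytic_at (hurwitz_regular a) s.
Proof.
intros Ha Hs.
(* The radius [s / 2] makes both exponents [- (1 + s -+ s / 2)] less than [-1]. *)
destruct (defect_coef_bound s (s / 2)) as [C HC]; [lra|lra|].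
exists (PS_plus (fun n => power_term (1 - s) (S n) a)
          (fun n => Series (fun k => defect_coef s (INR k + a) n))), (s / 2).
split; [lra|]; intros x Hx.
apply (is_pseries_plus (K := R_AbsRing) (V := R_NormedModule)).
- replace (1 - x) with (1 - s - (x - s)) by ring; apply is_pseries_power_term.
- apply (is_pseries_Series (fun k => defect_coef s (INR k + a))
           (fun k => C * (Rpower (INR k + a) (- (1 + s - s / 2))
                          + Rpower (INR k + a) (- (1 + s + s / 2)))) _ (s / 2)).
  + exact Hx.
  + intros k n; apply HC; generalize (pos_INR k); lra.
  + apply (ex_series_scal_l (K := R_AbsRing) C
           (fun k => Rpower (INR k + a) (- (1 + s - s / 2))
                     + Rpower (INR k + a) (- (1 + s + s / 2)))).
    apply (ex_series_plus (fun k => Rpower (INR k + a) (- (1 + s - s / 2)))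
             (fun k => Rpower (INR k + a) (- (1 + s + s / 2)))).
    * exists (hurwitz a (1 + s - s / 2)); apply is_series_hurwitz; lra.
    * exists (hurwitz a (1 + s + s / 2)); apply is_series_hurwitz; lra.
  + intros k; apply is_pseries_defect_coef.
Qed.

Lemma hurwitz_zeta_gt1 (a : R) (Z : C -> C) (s : R) :
  0 < a -> is_hurwitz_zeta a Z -> 1 < s -> Z (RtoC s) = RtoC (hurwitz a s).
Proof.
intros Ha [HZ _] Hs.
destruct (is_series_C _ _ (HZ (RtoC s) Hs)) as [Hre Him].
apply injective_projections.
- change (Re (Z (RtoC s)) = hurwitz a s).
  rewrite <- (is_series_unique _ _ Hre).
  rewrite <- (is_series_unique _ _ (is_series_hurwitz a s Ha Hs)).
  apply Series_ext; intros k; unfold Cpower, Re, Im; simpl.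
  rewrite Ropp_0, Rmult_0_l, cos_0, Rmult_1_r; reflexivity.
- change (Im (Z (RtoC s)) = 0).
  rewrite <- (is_series_unique _ _ Him).
  rewrite <- (Rmult_0_l (Series (fun _ => 0))), <- Series_scal_l.
  apply Series_ext; intros k; unfold Cpower, Re, Im; simpl.
  rewrite Ropp_0, Rmult_0_l, sin_0; ring.
Qed.

(** The function [hurwitz a] is the restriction to real [s > 0], [s <> 1], of
    the meromorphic continuation. *)
Lemma hurwitz_zeta_real (a : R) (Z : C -> C) (s : R) :
  0 < a -> is_hurwitz_zeta a Z -> 0 < s -> s <> 1 -> Z (RtoC s) = RtoC (hurwitz a s).
Proof.
intros Ha HZ Hs Hs1.
destruct (pole_removed a Z HZ) as [p [q [Hpq Han]]].
assert (Hp : p s - hurwitz_regular a s = 0).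
{ apply (real_analytic_identity (fun x => p x - hurwitz_regular a x) 0 1); [..|exact Hs].
  - intros x Hx; apply real_analytic_at_minus;
      [apply Han|now apply hurwitz_regular_analytic].
  - intros x Hx; rewrite hurwitz_regularE, (proj1 (Hpq x ltac:(lra))) by lra.
    rewrite (hurwitz_zeta_gt1 a Z x Ha HZ Hx); simpl; ring. }
assert (Hq : q s = 0).
{ apply (real_analytic_identity q 0 1); [..|exact Hs].
  - intros x Hx; apply Han.
  - intros x Hx; rewrite (proj2 (Hpq x ltac:(lra))).
    rewrite (hurwitz_zeta_gt1 a Z x Ha HZ Hx); simpl; ring. }
destruct (Hpq s Hs1) as [E1 E2].
rewrite hurwitz_regularE in Hp by exact Hs1; rewrite E1 in Hp; rewrite E2 in Hq.
apply injective_projections; apply (Rmult_eq_reg_l (s - 1)); try lra.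
- change (fst (Z (RtoC s))) with (Re (Z (RtoC s))); simpl; lra.
- change (snd (Z (RtoC s))) with (Im (Z (RtoC s))); simpl; lra.
Qed.

(** * Counting lattice points under the hyperbola *)

(** The number of [k : nat] with [k + a <= Y], for [a > 0]. *)
Definition shifted_count (a Y : R) : nat := Z.to_nat (up (Y - a)).

Lemma shifted_count_spec (a Y : R) (k : nat) :
  (k < shifted_count a Y)%nat <-> INR k + a <= Y.
Proof.
unfold shifted_count; destruct (archimed (Y - a)) as [H1 H2].
rewrite INR_IZR_INZ; split; intros H.
- assert (Hk : (Z.of_nat k + 1 <= up (Y - a))%Z) by lia.
  apply IZR_le in Hk; rewrite plus_IZR in Hk; lra.
- assert (Hk : (Z.of_nat k < up (Y - a))%Z) by (apply lt_IZR; lra); lia.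
Qed.

Lemma shifted_count_bounds (a Y : R) :
  Y < INR (shifted_count a Y) + a /\
  (a <= Y -> INR (shifted_count a Y) + a <= Y + 1).
Proof.
split.
- apply Rnot_le_lt; intros H; apply shifted_count_spec in H; lia.
- intros HY.
  assert (H0 : (0 < shifted_count a Y)%nat) by (apply shifted_count_spec; simpl; lra).
  assert (H := proj1 (shifted_count_spec a Y (pred (shifted_count a Y))) ltac:(lia)).
  rewrite <- (Nat.succ_pred_pos _ H0), S_INR; lra.
Qed.

Lemma shifted_count_approx (a Y : R) :
  0 < a -> 0 < Y -> Rabs (INR (shifted_count a Y) - Y) <= 1 + a.
Proof.
intros Ha HY; destruct (shifted_count_bounds a Y) as [H1 H2].
apply Rabs_le; split; [lra|].
destruct (Rle_lt_dec a Y) as [H|H]; [specialize (H2 H); lra|].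
replace (shifted_count a Y) with 0%nat; [simpl; lra|].
destruct (shifted_count a Y) as [|n] eqn:E; [reflexivity|exfalso].
assert (H0 := proj1 (shifted_count_spec a Y 0) ltac:(lia)); simpl in H0; lra.
Qed.

Lemma hurwitz_partial_sum (a s X : R) :
  0 < a <= X -> 0 < s -> s <> 1 ->
  Rabs (psum (fun k => Rpower (INR k + a) (- s)) (shifted_count a X)
        - (hurwitz a s + Rpower X (1 - s) / (1 - s))) <= 2 * Rpower X (- s).
Proof.
intros [Ha HX] Hs Hs1.
assert (H := psum_Rpower_hurwitz a s (shifted_count a X) Ha Hs Hs1).
destruct (shifted_count_bounds a X) as [B1 B2]; specialize (B2 HX).
set (v := INR (shifted_count a X) + a) in *.
assert (Hdec : Rpower v (- s) <= Rpower X (- s)) by (apply Rpower_decr; lra).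
destruct (Rpower_increment X v s Hs Hs1) as [I1 I2]; [lra|].
assert (Hv := Rpower_pos v (- s)); assert (HXp := Rpower_pos X (- s)).
assert (I0 : 0 <= (v - X) * Rpower v (- s)) by (apply Rmult_le_pos; lra).
assert (I3 : (v - X) * Rpower X (- s) <= 1 * Rpower X (- s))
  by (apply Rmult_le_compat_r; lra).
replace ((Rpower v (1 - s) - Rpower X (1 - s)) / (1 - s))
  with (Rpower v (1 - s) / (1 - s) - Rpower X (1 - s) / (1 - s)) in I1, I2
  by (unfold Rdiv; ring).
apply Rabs_le_between in H; apply Rabs_le; lra.
Qed.

(** The lattice points in the strip [k + a <= X] below the curve
    [v = X^(1+s) u^(-s)], which passes through [(X, X)]. *)
Lemma strip_count (a a' s X : R) :
  0 < a <= X -> 0 < a' -> 1 <= X -> 0 < s -> s <> 1 ->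
  Rabs (psum (fun k => INR (shifted_count a'
                         (Rpower X (1 + s) * Rpower (INR k + a) (- s))))
          (shifted_count a X)
        - (Rpower X (1 + s) * hurwitz a s + X * X / (1 - s)))
    <= (4 + 2 * a') * X.
Proof.
intros Ha Ha' HX Hs Hs1.
set (T := Rpower X (1 + s)); set (n := shifted_count a X).
assert (HT : 0 < T) by apply Rpower_pos.
assert (Hn : INR n <= 2 * X).
{ assert (H := proj2 (shifted_count_bounds a X) (proj2 Ha)); fold n in H; lra. }
assert (H1 := psum_Rabs_diff
  (fun k => INR (shifted_count a' (T * Rpower (INR k + a) (- s))))
  (fun k => T * Rpower (INR k + a) (- s)) (1 + a') n).
rewrite psum_scal in H1.
assert (H2 := hurwitz_partial_sum a s X Ha Hs Hs1); fold n in H2.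
set (A := psum (fun k => INR _) n) in *.
set (B := psum (fun k => Rpower _ _) n) in *.
assert (E1 : T * Rpower X (1 - s) = X * X).
{ unfold T; rewrite <- Rpower_plus; replace (1 + s + (1 - s)) with (1 + 1) by ring.
  rewrite Rpower_plus, Rpower_1; lra. }
assert (E2 : T * Rpower X (- s) = X).
{ unfold T; rewrite <- Rpower_plus; replace (1 + s + - s) with 1 by ring.
  rewrite Rpower_1; lra. }
replace (A - (T * hurwitz a s + X * X / (1 - s)))
  with ((A - T * B) + T * (B - (hurwitz a s + Rpower X (1 - s) / (1 - s))))
  by (rewrite <- E1; field; lra).
eapply Rle_trans; [apply Rabs_triang|].
rewrite Rabs_mult, (Rabs_pos_eq T) by lra.
apply (Rmult_le_compat_l T) in H2; [|lra].
assert (H3 : Rabs (A - T * B) <= INR n * (1 + a')).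
{ apply H1; intros k _; apply shifted_count_approx; [exact Ha'|].
  apply Rmult_lt_0_compat; [exact HT|apply Rpower_pos]. }
assert (H4 : INR n * (1 + a') <= 2 * X * (1 + a'))
  by (apply Rmult_le_compat_r; lra).
lra.
Qed.

Lemma cardinal_list {U : Type} (A : Ensemble U) (l : list U) :
  NoDup l -> (forall x, A x <-> List.In x l) -> cardinal U A (length l).
Proof.
intros Hl; revert A; induction Hl as [|x l Hx Hl IH]; intros A HA; simpl.
- replace A with (Empty_set U); [constructor|].
  apply Extensionality_Ensembles; split; intros y Hy; [destruct Hy|].
  now apply HA in Hy.
- replace A with (Add U (fun y => List.In y l) x).
  + constructor; [apply IH; intros y; reflexivity|exact Hx].
  + apply Extensionality_Ensembles; split; intros y Hy.
    * apply HA; destruct Hy as [y Hy|y Hy]; [now right|left; now destruct Hy].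
    * apply HA in Hy; destruct Hy as [->|Hy]; [right; constructor|now left].
Qed.

(** The concatenation of the lists [f 0], ..., [f (n - 1)]. *)
Fixpoint stack {U : Type} (f : nat -> list U) (n : nat) : list U :=
  match n with
  | O => nil
  | S m => stack f m ++ f m
  end.

Lemma in_stack {U : Type} (f : nat -> list U) (n : nat) (x : U) :
  List.In x (stack f n) <-> exists k, (k < n)%nat /\ List.In x (f k).
Proof.
induction n as [|n IH]; simpl.
- split; [intros []|intros [k [Hk _]]; lia].
- rewrite in_app_iff, IH; split.
  + intros [[k [Hk H]]|H]; [exists k; split; [lia|exact H]|exists n; split; [lia|exact H]].
  + intros [k [Hk H]].
    destruct (Nat.eq_dec k n) as [->|Hkn]; [now right|left; exists k; split; [lia|exact H]].
Qed.

Lemma NoDup_stack {U : Type} (f : nat -> list U) (g : U -> nat) (n : nat) :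
  (forall k, NoDup (f k)) -> (forall k x, List.In x (f k) -> g x = k) -> NoDup (stack f n).
Proof.
intros Hf Hg; induction n as [|n IH]; simpl; [constructor|].
apply NoDup_app; [exact IH|apply Hf|].
intros x Hx Hxn; apply in_stack in Hx; destruct Hx as [k [Hk Hx]].
apply Hg in Hx; apply Hg in Hxn; lia.
Qed.

Lemma length_stack {U : Type} (f : nat -> list U) (n : nat) :
  INR (length (stack f n)) = psum (fun k => INR (length (f k))) n.
Proof.
induction n as [|n IH]; simpl; [reflexivity|].
now rewrite length_app, plus_INR, IH.
Qed.

(** Dirichlet's hyperbola method: a planar set covered by the strips
    [k1 < n1] and [k2 < n2], whose rows and columns are initial segments and
    which contains the rectangle [n1 x n2], is counted by strips. *)
Lemma hyperbola_method (P : Ensemble (nat * nat)) (m1 m2 : nat -> nat) (n1 n2 D : nat) :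
  (forall k1 k2, P (k1, k2) <-> (k2 < m1 k1)%nat) ->
  (forall k1 k2, P (k1, k2) <-> (k1 < m2 k2)%nat) ->
  (forall k1 k2, (k1 < n1)%nat -> (k2 < n2)%nat -> P (k1, k2)) ->
  (forall k1 k2, P (k1, k2) -> (k1 < n1)%nat \/ (k2 < n2)%nat) ->
  cardinal (nat * nat) P D ->
  INR D = psum (fun k => INR (m1 k)) n1 + psum (fun k => INR (m2 k)) n2
          - INR n1 * INR n2.
Proof.
intros Hrow Hcol Hrect Hcover HD.
assert (Hmin : forall k, (k < n2)%nat -> (n1 <= m2 k)%nat).
{ intros k Hk; destruct n1 as [|n]; [lia|].
  assert (H : P (n, k)) by (apply Hrect; lia); apply Hcol in H; lia. }
set (f1 := fun k1 => map (fun k2 => (k1, k2)) (seq 0 (m1 k1))).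
(* The second strip omits the rectangle, already counted in the first. *)
set (f2 := fun k2 => map (fun k1 => (k1, k2)) (seq n1 (m2 k2 - n1))).
assert (In1 : forall k x, List.In x (f1 k) <-> fst x = k /\ (snd x < m1 k)%nat).
{ intros k [i j]; unfold f1; rewrite in_map_iff; simpl; split.
  - intros [y [E Hy]]; injection E as <- <-; apply in_seq in Hy; split; [reflexivity|lia].
  - intros [-> Hj]; exists j; split; [reflexivity|apply in_seq; lia]. }
assert (In2 : forall k x, List.In x (f2 k) <-> snd x = k /\ (n1 <= fst x < m2 k)%nat).
{ intros k [i j]; unfold f2; rewrite in_map_iff; simpl; split.
  - intros [y [E Hy]]; injection E as <- <-; apply in_seq in Hy; split; [reflexivity|lia].
  - intros [-> Hj]; exists i; split; [reflexivity|apply in_seq; lia]. }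
assert (Hcard : cardinal (nat * nat) P (length (stack f1 n1 ++ stack f2 n2))).
{ apply cardinal_list.
  - apply NoDup_app.
    + apply NoDup_stack with fst; [|intros k x Hx; now apply In1 in Hx].
      intros k; apply NoDup_map_NoDup_ForallPairs; [|apply seq_NoDup].
      intros x y _ _ E; now injection E.
    + apply NoDup_stack with snd; [|intros k x Hx; now apply In2 in Hx].
      intros k; apply NoDup_map_NoDup_ForallPairs; [|apply seq_NoDup].
      intros x y _ _ E; now injection E.
    + intros x H1 H2; apply in_stack in H1; apply in_stack in H2.
      destruct H1 as [k [Hk H1]], H2 as [k' [Hk' H2]].
      apply In1 in H1; apply In2 in H2; lia.
  - intros [i j]; rewrite in_app_iff, !in_stack; split.
    + intros HP; destruct (Nat.lt_ge_cases i n1) as [Hi|Hi].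
      * left; exists i; split; [exact Hi|]; apply In1; split; [reflexivity|].
        now apply Hrow.
      * right; exists j; destruct (Hcover i j HP) as [H|H]; [lia|].
        split; [exact H|]; apply In2; split; [reflexivity|].
        split; [exact Hi|now apply Hcol].
    + intros [[k [Hk H]]|[k [Hk H]]].
      * apply In1 in H; simpl in H; destruct H as [-> H]; now apply Hrow.
      * apply In2 in H; simpl in H; destruct H as [-> [_ H]]; now apply Hcol. }
rewrite (cardinal_unicity _ _ _ HD _ Hcard), length_app, plus_INR, !length_stack.
unfold Rminus; rewrite Rplus_assoc; f_equal.
- clear; induction n1 as [|n IH]; simpl; [reflexivity|].
  rewrite IH; unfold f1; now rewrite length_map, length_seq.
- clear - Hmin; induction n2 as [|n IH]; [simpl; ring|].
  rewrite S_INR; simpl psum; rewrite IH by (intros k Hk; apply Hmin; lia).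
  unfold f2; rewrite length_map, length_seq, minus_INR by (apply Hmin; lia); ring.
Qed.

(** The curve [u^beta1 v^beta2 = X^(beta1 + beta2)] as a graph over [u]. *)
Lemma hyperbola_graph (beta1 beta2 u v X : R) :
  0 < beta2 -> 0 < u -> 0 < v -> 0 < X ->
  (beta1 * ln u + beta2 * ln v <= (beta1 + beta2) * ln X <->
   v <= Rpower X (1 + beta1 / beta2) * Rpower u (- (beta1 / beta2))).
Proof.
intros Hb Hu Hv HX.
set (W := Rpower X _ * _).
assert (HW : 0 < W) by (apply Rmult_lt_0_compat; apply Rpower_pos).
assert (E : beta2 * ln W = (beta1 + beta2) * ln X - beta1 * ln u).
{ unfold W; rewrite ln_mult by apply Rpower_pos; unfold Rpower; rewrite !ln_exp.
  field; lra. }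
split; intros H.
- apply Rnot_lt_le; intros Hlt; apply ln_increasing in Hlt; [|exact HW].
  apply (Rmult_lt_compat_l beta2) in Hlt; lra.
- assert (H' : ln v <= ln W) by (apply ln_le; assumption).
  apply (Rmult_le_compat_l beta2) in H'; lra.
Qed.

Lemma exp_le_iff (x y : R) : exp x <= exp y <-> x <= y.
Proof.
split; intros H; apply Rnot_lt_le; intros Hlt.
- apply exp_increasing in Hlt; lra.
- apply exp_lt_inv in Hlt; lra.
Qed.

Lemma lattice_set_ln (beta1 beta2 c1 c2 b1 b2 lambda : R) (k1 k2 : nat) :
  0 < c1 -> 0 < c2 -> 0 < b1 -> 0 < b2 -> 0 < lambda ->
  (lattice_set beta1 beta2 c1 c2 b1 b2 lambda (k1, k2) <->
   beta1 * ln (INR k1 + b1 / c1) + beta2 * ln (INR k2 + b2 / c2)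
     <= ln lambda - beta1 * ln c1 - beta2 * ln c2).
Proof.
intros Hc1 Hc2 Hb1 Hb2 Hl; unfold lattice_set; simpl.
assert (E : forall c b k, 0 < c -> 0 < b ->
          ln (c * INR k + b) = ln c + ln (INR k + b / c)).
{ intros c b k Hc Hb; rewrite <- ln_mult; [f_equal; field; lra|exact Hc|].
  generalize (pos_INR k) (Rdiv_lt_0_compat _ _ Hb Hc); lra. }
unfold Rpower; rewrite <- exp_plus, !E by assumption.
rewrite <- (exp_ln lambda Hl) at 1.
rewrite exp_le_iff; split; intros H; lra.
Qed.

(** The asymptotics in the normalised form: [X] is the side of the largest
    square below the hyperbola. *)
Lemma lattice_count (beta1 beta2 c1 c2 b1 b2 lambda X : R) :
  0 < beta1 -> beta1 < beta2 -> 0 < c1 -> 0 < c2 -> 0 < b1 -> 0 < b2 ->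
  0 < lambda -> 1 <= X -> b1 / c1 <= X -> b2 / c2 <= X ->
  (beta1 + beta2) * ln X = ln lambda - beta1 * ln c1 - beta2 * ln c2 ->
  Rabs (INR (Dcount beta1 beta2 c1 c2 b1 b2 lambda)
        - (Rpower X (1 + beta2 / beta1) * hurwitz (b2 / c2) (beta2 / beta1)
           + Rpower X (1 + beta1 / beta2) * hurwitz (b1 / c1) (beta1 / beta2)))
    <= (11 + 4 * (b1 / c1) + 3 * (b2 / c2)) * X.
Proof.
intros Hb1 Hb12 Hc1 Hc2 Hb1' Hb2' Hl HX HX1 HX2 EX.
set (a1 := b1 / c1) in *; set (a2 := b2 / c2) in *.
assert (Ha1 : 0 < a1) by now apply Rdiv_lt_0_compat.
assert (Ha2 : 0 < a2) by now apply Rdiv_lt_0_compat.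
set (s1 := beta1 / beta2); set (s2 := beta2 / beta1).
assert (Hs1 : 0 < s1) by (apply Rdiv_lt_0_compat; lra).
assert (Hs2 : 0 < s2) by (apply Rdiv_lt_0_compat; lra).
assert (Hs1' : s1 < 1) by (apply Rlt_div_l; lra).
assert (Hs2' : 1 < s2) by (apply Rlt_div_r; lra).
assert (HP := fun k1 k2 => lattice_set_ln beta1 beta2 c1 c2 b1 b2 lambda k1 k2
                             Hc1 Hc2 Hb1' Hb2' Hl).
rewrite <- EX in HP; fold a1 a2 in HP.
assert (Hpos1 : forall k, 0 < INR k + a1) by (intros k; generalize (pos_INR k); lra).
assert (Hpos2 : forall k, 0 < INR k + a2) by (intros k; generalize (pos_INR k); lra).
set (n1 := shifted_count a1 X); set (n2 := shifted_count a2 X).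
assert (HD := hyperbola_method
  (lattice_set beta1 beta2 c1 c2 b1 b2 lambda)
  (fun k => shifted_count a2 (Rpower X (1 + s1) * Rpower (INR k + a1) (- s1)))
  (fun k => shifted_count a1 (Rpower X (1 + s2) * Rpower (INR k + a2) (- s2)))
  n1 n2 (Dcount beta1 beta2 c1 c2 b1 b2 lambda)).
rewrite HD; clear HD.
- assert (S1 := strip_count a1 a2 s1 X (conj Ha1 HX1) Ha2 HX Hs1 ltac:(lra)).
  assert (S2 := strip_count a2 a1 s2 X (conj Ha2 HX2) Ha1 HX Hs2 ltac:(lra)).
  fold n1 in S1; fold n2 in S2.
  set (A1 := psum _ n1) in *; set (A2 := psum _ n2) in *.
  assert (R1 := shifted_count_approx a1 X Ha1 ltac:(lra)); fold n1 in R1.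
  assert (R2 := shifted_count_approx a2 X Ha2 ltac:(lra)); fold n2 in R2.
  assert (Hn2 : INR n2 <= 2 * X).
  { assert (H := proj2 (shifted_count_bounds a2 X) HX2); fold n2 in H; lra. }
  (* The quadratic main terms of the strips add up to the area of the square. *)
  assert (Hsq : X * X / (1 - s1) + X * X / (1 - s2) = X * X).
  { unfold s1, s2; field; repeat split; lra. }
  replace (A1 + A2 - INR n1 * INR n2
           - (Rpower X (1 + s2) * hurwitz a2 s2 + Rpower X (1 + s1) * hurwitz a1 s1))
    with ((A1 - (Rpower X (1 + s1) * hurwitz a1 s1 + X * X / (1 - s1)))
          + (A2 - (Rpower X (1 + s2) * hurwitz a2 s2 + X * X / (1 - s2)))
          + (- ((INR n1 - X) * INR n2) + - (X * (INR n2 - X)))) by lra.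
  eapply Rle_trans; [apply Rabs_triang|].
  eapply Rle_trans; [apply Rplus_le_compat; apply Rabs_triang|].
  rewrite !Rabs_Ropp, !Rabs_mult, (Rabs_pos_eq X), (Rabs_pos_eq (INR n2))
    by (try apply pos_INR; lra).
  assert (P1 : Rabs (INR n1 - X) * INR n2 <= (1 + a1) * (2 * X))
    by (apply Rmult_le_compat; [apply Rabs_pos|apply pos_INR|exact R1|exact Hn2]).
  assert (P2 : X * Rabs (INR n2 - X) <= X * (1 + a2))
    by (apply Rmult_le_compat_l; lra).
  lra.
- intros k1 k2; rewrite HP, shifted_count_spec; apply hyperbola_graph; auto; lra.
- intros k1 k2; rewrite HP, shifted_count_spec; unfold s2.
  rewrite <- hyperbola_graph by (auto; lra).
  rewrite (Rplus_comm beta2 beta1), (Rplus_comm (beta2 * _)); reflexivity.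
- intros k1 k2 H1 H2; apply shifted_count_spec in H1; apply shifted_count_spec in H2.
  apply HP.
  assert (L1 : ln (INR k1 + a1) <= ln X) by (apply ln_le; auto).
  assert (L2 : ln (INR k2 + a2) <= ln X) by (apply ln_le; auto).
  apply (Rmult_le_compat_l beta1) in L1; [|lra].
  apply (Rmult_le_compat_l beta2) in L2; [|lra].
  lra.
- intros k1 k2 H; apply HP in H; unfold n1, n2; rewrite !shifted_count_spec.
  destruct (Rle_lt_dec (INR k1 + a1) X) as [|G1]; [now left|right].
  apply Rnot_lt_le; intros G2.
  apply ln_increasing in G1; [|lra]; apply ln_increasing in G2; [|lra].
  apply (Rmult_lt_compat_l beta1) in G1; [|lra].
  apply (Rmult_lt_compat_l beta2) in G2; [|lra].
  lra.
- apply Dcount_spec; lra.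
Qed.

Theorem lemma2p6 :
  forall zeta : R -> C -> C,
    (forall a : R, 0 < a -> is_hurwitz_zeta a (zeta a)) ->
  forall beta1 beta2 c1 c2 b1 b2 : R,
    0 < beta1 -> beta1 < beta2 ->
    0 < c1 -> 0 < c2 -> 0 < b1 -> 0 < b2 ->
  exists K Lambda : R, forall lambda : R, Lambda <= lambda ->
    Cmod (RtoC (INR (Dcount beta1 beta2 c1 c2 b1 b2 lambda))
          - (zeta (b2 / c2)%R (RtoC (beta2 / beta1)%R)
               / RtoC (c1 * Rpower c2 (beta2 / beta1))%R
               * RtoC (Rpower lambda (1 / beta1)%R)
             + zeta (b1 / c1)%R (RtoC (beta1 / beta2)%R)
               / RtoC (c2 * Rpower c1 (beta1 / beta2))%R
               * RtoC (Rpower lambda (1 / beta2)%R)))%C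
    <= K * Rpower lambda (1 / (beta1 + beta2)).
Proof.
intros zeta Hzeta beta1 beta2 c1 c2 b1 b2 Hb1 Hb12 Hc1 Hc2 Hb1' Hb2'.
set (g := beta1 * ln c1 + beta2 * ln c2).
set (X0 := Rmax 1 (Rmax (b1 / c1) (b2 / c2))).
assert (HX0 : 1 <= X0) by apply Rmax_l.
assert (HX1 : b1 / c1 <= X0) by (eapply Rle_trans; [apply Rmax_l|apply Rmax_r]).
assert (HX2 : b2 / c2 <= X0) by (eapply Rle_trans; [apply Rmax_r|apply Rmax_r]).
(* [X = exp (- g / (beta1 + beta2)) * lambda ^ (1 / (beta1 + beta2))], and
   [X >= X0] as soon as [lambda >= exp ((beta1 + beta2) * ln X0 + g)]. *)
exists ((11 + 4 * (b1 / c1) + 3 * (b2 / c2)) * exp (- g / (beta1 + beta2))),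
  (exp ((beta1 + beta2) * ln X0 + g)).
intros lambda Hlambda.
assert (Hl : 0 < lambda) by (eapply Rlt_le_trans; [apply exp_pos|exact Hlambda]).
set (X := exp ((ln lambda - g) / (beta1 + beta2))).
assert (EX : ln X = (ln lambda - g) / (beta1 + beta2)) by apply ln_exp.
assert (HX : X0 <= X).
{ rewrite <- (exp_ln X0) by lra; unfold X.
  apply (proj2 (exp_le_iff _ _)), Rle_div_r; [lra|].
  assert (H : ln (exp ((beta1 + beta2) * ln X0 + g)) <= ln lambda)
    by (apply ln_le; [apply exp_pos|exact Hlambda]).
  rewrite ln_exp in H; lra. }
assert (Hs1 : 0 < beta1 / beta2 < 1)
  by (split; [apply Rdiv_lt_0_compat|apply Rlt_div_l]; lra).
assert (Hs2 : 1 < beta2 / beta1) by (apply Rlt_div_r; lra).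
assert (Ha1 : 0 < b1 / c1) by now apply Rdiv_lt_0_compat.
assert (Ha2 : 0 < b2 / c2) by now apply Rdiv_lt_0_compat.
assert (Hcount := lattice_count beta1 beta2 c1 c2 b1 b2 lambda X Hb1 Hb12 Hc1 Hc2
                    Hb1' Hb2' Hl ltac:(lra) ltac:(lra) ltac:(lra)
                    ltac:(rewrite EX; unfold g; field; lra)).
rewrite (hurwitz_zeta_real _ _ (beta2 / beta1) Ha2 (Hzeta _ Ha2)) by lra.
rewrite (hurwitz_zeta_real _ _ (beta1 / beta2) Ha1 (Hzeta _ Ha1)) by lra.
assert (Hd1 : 0 < c1 * Rpower c2 (beta2 / beta1))
  by (apply Rmult_lt_0_compat; [exact Hc1|apply Rpower_pos]).
assert (Hd2 : 0 < c2 * Rpower c1 (beta1 / beta2))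
  by (apply Rmult_lt_0_compat; [exact Hc2|apply Rpower_pos]).
rewrite <- !RtoC_div, <- !RtoC_mult, <- RtoC_plus, <- RtoC_minus, Cmod_R by lra.
assert (E1 : Rpower X (1 + beta2 / beta1)
             = / (c1 * Rpower c2 (beta2 / beta1)) * Rpower lambda (1 / beta1)).
{ rewrite <- (exp_ln c1 Hc1) at 1; unfold Rpower.
  rewrite <- exp_plus, <- exp_Ropp, <- exp_plus, EX; f_equal.
  unfold g; field; lra. }
assert (E2 : Rpower X (1 + beta1 / beta2)
             = / (c2 * Rpower c1 (beta1 / beta2)) * Rpower lambda (1 / beta2)).
{ rewrite <- (exp_ln c2 Hc2) at 1; unfold Rpower.
  rewrite <- exp_plus, <- exp_Ropp, <- exp_plus, EX; f_equal.
  unfold g; field; lra. }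
assert (E3 : X = exp (- g / (beta1 + beta2)) * Rpower lambda (1 / (beta1 + beta2))).
{ unfold X, Rpower; rewrite <- exp_plus; f_equal; field; lra. }
rewrite Rmult_assoc, <- E3.
rewrite E1, E2 in Hcount.
eapply Rle_trans; [|exact Hcount]; right; f_equal; unfold Rdiv; ring.
Qed.
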